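(* Let $n\ge 1$ and let $w=(w_1,\dots,w_n)\in\mathbb{R}^n$ satisfy $w_1\ge w_2\ge\cdots\ge w_n\ge 0$. If $w_1>0$, then the function $\Omega_w:\mathbb{R}^n\to\mathbb{R}$, $\Omega_w(x)=\sum_{i=1}^n w_i|\grave{x}_i|$, is a norm on $\mathbb{R}^n$.
   Context: For $x\in\mathbb{R}^n$, $\grave{x}\in\mathbb{R}^n$ denotes the vector obtained from $x$ by sorting its entries in non-increasing order of magnitude, so $|\grave{x}_1|\ge\cdots\ge|\grave{x}_n|$ (ties broken by an arbitrary fixed rule). $\Omega_w$ is the decreasing weighted sorted $\ell_1$ (DWSL1) function. *)

(* Defs.v *)
From HB Require Import structures.
From mathcomp Require Import all_boot all_order all_algebra all_fingroup.
From mathcomp Require Import reals.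

Set Implicit Arguments.
Unset Strict Implicit.
Unset Printing Implicit Defensive.

Import Order.TTheory GRing.Theory Num.Theory.
Local Open Scope ring_scope.

Definition is_norm (R : realType) (V : lmodType R) (f : V -> R) : Prop :=
  [/\ forall x, 0 <= f x,
      forall x, f x = 0 -> x = 0,
      forall (a : R) x, f (a *: x) = `|a| * f x
    & forall x y, f (x + y) <= f x + f y].

(* A tie-breaking rule for sorting by magnitude: p x is a permutation of the
   indices putting the entries of x in non-increasing order of absolute value,
   x 0 (p x i) being the i-th entry of the sorted vector. When x has entries of
   equal magnitude, the choice of p x is unconstrained. *)
Definition magnitude_sorting_rule (R : realType) (n : nat)
    (p : 'rV[R]_n -> 'S_n) : Prop :=
  forall (x : 'rV[R]_n) (i j : 'I_n),
    (i <= j)%N -> `|x 0 (p x j)| <= `|x 0 (p x i)|.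

Definition mag_sort (R : realType) (n : nat)
    (p : 'rV[R]_n -> 'S_n) (x : 'rV[R]_n) : 'rV[R]_n :=
  col_perm (p x) x.

Definition DWSL1 (R : realType) (n : nat)
    (p : 'rV[R]_n -> 'S_n) (w x : 'rV[R]_n) : R :=
  \sum_(i < n) w 0 i * `|mag_sort p x 0 i|.

Lemma magnitude_sorting_rule_exists (R : realType) (n : nat) :
  exists p : 'rV[R]_n -> 'S_n, magnitude_sorting_rule p.
Proof.
pose r (x : 'rV[R]_n) (i j : 'I_n) := `|x 0 j| <= `|x 0 i|.
have sx x : {s : 'S_n | sort_tuple (r x) (ord_tuple n)
                        == [tuple tnth (ord_tuple n) (s i) | i < n]}.
  apply: sigW; have /tuple_permP[s Es] :
    perm_eq (sort_tuple (r x) (ord_tuple n)) (ord_tuple n).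
    by rewrite /= perm_sort.
  by exists s; apply/eqP/val_inj; rewrite /= in Es *.
exists (fun x => sval (sx x)) => x i j le_ij.
case: (sx x) => s /= /eqP Es.
have Et (k : 'I_n) : s k = tnth (sort_tuple (r x) (ord_tuple n)) k.
  by rewrite Es tnth_mktuple tnth_ord_tuple.
have r_tr : transitive (r x) by move=> b a c ab bc; apply: le_trans bc ab.
have r_refl : reflexive (r x) by move=> a; apply: lexx.
have r_tot : total (r x) by move=> a b; apply: le_total.
have srt := sorted_leq_nth r_tr r_refl i (sort_sorted r_tot (ord_tuple n)).
rewrite !Et !(tnth_nth i) /=.
by apply: srt; rewrite ?inE ?size_sort ?size_tuple.
Qed.

(* Main.v *)
Require Import Defs.
From mathcomp Require Import all_boot all_order all_algebra all_fingroup.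
From mathcomp Require Import reals.
From mathcomp Require Import ring.

Set Implicit Arguments.
Unset Strict Implicit.
Unset Printing Implicit Defensive.

Import Order.TTheory GRing.Theory Num.Theory.
Local Open Scope ring_scope.

(** By the rearrangement inequality, [DWSL1 p w x] is the maximum of
    [\sum_i w_i |x_(s i)|] over all permutations [s]. Each of these sums is a
    seminorm in [x], hence so is their maximum. *)

(** The maximum is attained at [s = p x] ([DWSL1E]) and bounds all other orderings
    ([sum_perm_le_DWSL1]); homogeneity and the triangle inequality follow from these two facts.
    Definiteness is separate: the first weight is positive and multiplies the largest magnitude. *)

(* Any permutation is sorted into the identity by successively fixing
   0, 1, 2, ... with transpositions, none of which decreases the sum. *)
Lemma rearrangement_prefix (R : realDomainType) (n : nat) (a b : 'I_n -> R)
    (a_noninc : forall i j : 'I_n, (i <= j)%N -> a j <= a i)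
    (b_noninc : forall i j : 'I_n, (i <= j)%N -> b j <= b i)
    (s : 'S_n) (k : nat) :
  (k <= n)%N ->
  exists2 t : 'S_n, forall i : 'I_n, (i < k)%N -> t i = i
    & \sum_i a i * b (s i) <= \sum_i a i * b (t i).
Proof.
elim: k => [|k IHk] lt_kn; first by exists s.
have [t t_fix le_st] := IHk (ltnW lt_kn).
pose ko := Ordinal lt_kn; pose j := (t^-1)%g ko.
have tj : t j = ko by rewrite permKV.
have le_kj : (k <= j)%N.
  by rewrite leqNgt; apply/negP => lt_jk; move: tj (lt_jk);
     rewrite t_fix // => ->; rewrite ltnn.
have le_ktk : (k <= t ko)%N.
  rewrite leqNgt; apply/negP => lt_tk; have := t_fix _ lt_tk.
  by move/perm_inj => tko; rewrite tko ltnn in lt_tk.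
(* The left factor acts first, so [ko] goes to [ko] and [j] to [t ko]; every other index keeps its
   image. *)
exists (tperm ko j * t)%g => [i|].
  rewrite ltnS leq_eqVlt permM => /orP[/eqP ik|lt_ik].
    by have -> : i = ko by [apply: val_inj]; rewrite tpermL.
  rewrite tpermD ?t_fix // neq_ltn ?lt_ik ?orbT //=.
  by rewrite (leq_trans lt_ik le_kj) orbT.
apply: le_trans le_st _.
have [jk|jNk] := eqVneq j ko; first by rewrite jk tperm1 mul1g.
rewrite (bigD1 ko) //= (bigD1 j) //= [leRHS](bigD1 ko) //= [X in _ <= _ + X](bigD1 j) //=.
rewrite !permM tpermL tpermR tj !addrA; apply: lerD; last first.
  by apply: ler_sum => i /andP[ik ij]; rewrite permM tpermD // eq_sym.
(* The gain from the swap is a product of two differences, nonnegative since [k <= j] and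
   [k <= t ko]. *)
rewrite -subr_ge0.
have -> : a ko * b ko + a j * b (t ko) - (a ko * b (t ko) + a j * b ko)
          = (a ko - a j) * (b ko - b (t ko)) by ring.
by rewrite mulr_ge0 // subr_ge0 ?a_noninc ?b_noninc.
Qed.

Lemma rearrangement (R : realDomainType) (n : nat) (a b : 'I_n -> R)
    (a_noninc : forall i j : 'I_n, (i <= j)%N -> a j <= a i)
    (b_noninc : forall i j : 'I_n, (i <= j)%N -> b j <= b i) (s : 'S_n) :
  \sum_i a i * b (s i) <= \sum_i a i * b i.
Proof.
have [t t1 /le_trans->//] := rearrangement_prefix a_noninc b_noninc s (leqnn n).
by apply: ler_sum => i _; rewrite t1.
Qed.

Lemma DWSL1E (R : realType) (n : nat) (p : 'rV[R]_n -> 'S_n) (w x : 'rV[R]_n) :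
  DWSL1 p w x = \sum_(i < n) w 0 i * `|x 0 (p x i)|.
Proof. by apply: eq_bigr => i _; rewrite mxE. Qed.

Lemma sum_perm_le_DWSL1 (R : realType) (n : nat) (p : 'rV[R]_n -> 'S_n)
    (hp : magnitude_sorting_rule p) (w : 'rV[R]_n)
    (w_noninc : forall i j : 'I_n, (i <= j)%N -> w 0 j <= w 0 i)
    (x : 'rV[R]_n) (s : 'S_n) :
  \sum_(i < n) w 0 i * `|x 0 (s i)| <= DWSL1 p w x.
Proof.
rewrite DWSL1E.
(* Relative to the sorted magnitudes, the ordering [s] is [s] followed by the inverse of [p x]. *)
have := rearrangement w_noninc (hp x) (s * (p x)^-1)%g.
by under eq_bigr => i _ do rewrite permM permKV.
Qed.

Theorem lemma2 (R : realType) (n : nat) (hn : (0 < n)%N)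
    (p : 'rV[R]_n -> 'S_n) (hp : magnitude_sorting_rule p)
    (w : 'rV[R]_n)
    (w_noninc : forall i j : 'I_n, (i <= j)%N -> w 0 j <= w 0 i)
    (w_ge0 : forall i : 'I_n, 0 <= w 0 i)
    (w1_gt0 : 0 < w 0 (Ordinal hn)) :
  is_norm (DWSL1 p w).
Proof.
have term_ge0 (x : 'rV[R]_n) i : 0 <= w 0 i * `|x 0 (p x i)| by rewrite mulr_ge0.
have le_DWSL1 := @sum_perm_le_DWSL1 _ _ _ hp _ w_noninc.
have sumZ (a : R) (x : 'rV[R]_n) (s : 'S_n) :
    \sum_i w 0 i * `|(a *: x) 0 (s i)| = `|a| * \sum_i w 0 i * `|x 0 (s i)|.
  by rewrite mulr_sumr; apply: eq_bigr => i _; rewrite mxE normrM mulrCA.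
split=> [x|x|a x|x y].
- by rewrite DWSL1E sumr_ge0.
- rewrite DWSL1E => /eqP; rewrite psumr_eq0 // => /allP/(_ (Ordinal hn)).
  rewrite mem_index_enum => /(_ isT); rewrite mulf_eq0 gt_eqF //= => /eqP x1_eq0.
  apply/rowP => j; rewrite mxE; apply/eqP; rewrite -normr_le0 -x1_eq0.
  by rewrite -[j](permKV (p x)) hp.
(* [p (a *: x)] and [p x] may differ, so each side is bounded by using its own sorting permutation
   as a competitor for the other. *)
- apply/le_anti/andP; split.
    by rewrite DWSL1E sumZ ler_wpM2l ?le_DWSL1.
  by rewrite (DWSL1E p w x) -sumZ le_DWSL1.
(* The permutation sorting [x + y] serves as a competitor for both [x] and [y]. *)
- rewrite DWSL1E.
  apply: le_trans (lerD (le_DWSL1 x (p (x + y))) (le_DWSL1 y (p (x + y)))).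
  rewrite -big_split; apply: ler_sum => i _ /=.
  by rewrite -mulrDr ler_wpM2l // mxE ler_normD.
Qed.
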